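(* Let $\{e\}$ be the trivial group and let $\{a\}$ be a singleton set. Let $(F,\{a\})_{\{e\}}$ be the soft group given by $F:\{a\}\to P(\{e\})$, $F(a)=\{e\}$. Then $(F,\{a\})_{\{e\}}$ is a final object in the soft group category $SGp$.
   Context: A soft group $(F,A)_G$ over a group $G$ is a pair consisting of a set $A$ of parameters (a subset of some set $E$ of parameters) and a function $F:A\to P(G)$ into the power set of $G$ such that $F(a)$ is a subgroup of $G$ for every $a\in A$. For a group homomorphism $f:G\to K$, $\hat f:P(G)\to P(K)$ denotes the direct image map $\hat f(S)=f(S)$. A soft group homomorphism $(f,p):(F,A)_G\to(H,B)_K$ is a pair consisting of a group homomorphism $f:G\to K$ and a function $p:A\to B$ such that $\hat f\circ F=H\circ p$. Two soft group homomorphisms $(f,p)$ and $(g,q)$ are equal if and only if $f=g$ and $p=q$. $SGp$ is the category whose objects are soft groups (over arbitrary groups and parameter sets), whose morphisms are soft group homomorphisms, with componentwise composition $(g,q)\circ(f,p)=(g\circ f,q\circ p)$ and identities $(1_G,1_A)$. *)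

(* Defs.v *)
From HB Require Import structures.
From mathcomp Require Import all_boot.
From mathcomp Require Import boolp classical_sets.

Set Implicit Arguments.
Unset Strict Implicit.
Unset Printing Implicit Defensive.

Local Open Scope classical_set_scope.
Local Open Scope group_scope.

Record category := Category {
  obj :> Type;
  hom : obj -> obj -> Type;
  idm : forall X, hom X X;
  compm : forall X Y Z, hom Y Z -> hom X Y -> hom X Z;
  comp1m : forall X Y (f : hom X Y), compm (idm Y) f = f;
  compm1 : forall X Y (f : hom X Y), compm f (idm X) = f;
  compA : forall X Y Z W (h : hom Z W) (g : hom Y Z) (f : hom X Y),
    compm h (compm g f) = compm (compm h g) f
}.

Definition is_final (C : category) (Z : C) : Prop :=
  forall X : C, exists! f : hom X Z, True.

(* (F, A)_G with G an arbitrary, possibly infinite, group.  A [groupType]      *)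
(* also carries a choice structure, which every type has classically and which *)
(* morphisms ignore.                                                           *)
Record softGroup := SoftGroup {
  sgGroup : groupType;
  sgUniv : Type;
  sgParam : set sgUniv;
  sgFun : sgParam -> set sgGroup;
  sgFun_closed : forall a : sgParam, group_closed [in sgFun a]
}.
Arguments sgParam : clear implicits.
Arguments sgFun : clear implicits.

Record softHom (X Y : softGroup) := SoftHom {
  shMor : {multiplicative sgGroup X -> sgGroup Y};
  shPar : sgParam X -> sgParam Y;
  shE : image^~ shMor \o sgFun X = sgFun Y \o shPar
}.

Lemma multiplicative_eq (G H : groupType) (f g : {multiplicative G -> H}) :
  f = g :> (G -> H) -> f = g.
Proof.
case: f g => [f [[fM]]] [g [[gM]]] /= fg; case: _ / fg in gM *.
by rewrite (Prop_irrelevance fM gM).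
Qed.

Lemma softHom_eq (X Y : softGroup) (u v : softHom X Y) :
  u = v <-> shMor u = shMor v /\ shPar u = shPar v.
Proof.
split=> [->//|]; case: u v => [f p fp] [g q gq] /= [fg pq].
case: _ / fg in gq *; case: _ / pq in gq *.
by rewrite (Prop_irrelevance fp gq).
Qed.

Fact softHom_id_subproof (X : softGroup) :
  image^~ idfun \o sgFun X = sgFun X \o idfun.
Proof. by apply/funext => a /=; rewrite image_id. Qed.

Definition softHom_id (X : softGroup) : softHom X X :=
  @SoftHom X X (idfun : {multiplicative _ -> _}) idfun (softHom_id_subproof X).

Fact softHom_comp_subproof (X Y Z : softGroup)
    (v : softHom Y Z) (u : softHom X Y) :
  image^~ (shMor v \o shMor u) \o sgFun X
    = sgFun Z \o (shPar v \o shPar u).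
Proof.
apply/funext => a /=; rewrite -image_comp.
have /(congr1 (fun k => k a)) /= -> := shE u.
by have /(congr1 (fun k => k (shPar u a))) /= -> := shE v.
Qed.

Definition softHom_comp (X Y Z : softGroup)
    (v : softHom Y Z) (u : softHom X Y) : softHom X Z :=
  @SoftHom X Z (shMor v \o shMor u : {multiplicative _ -> _})
    (shPar v \o shPar u) (softHom_comp_subproof v u).

Fact softHom_comp1m X Y (u : softHom X Y) : softHom_comp (softHom_id Y) u = u.
Proof. by apply/softHom_eq; split=> //; apply: multiplicative_eq. Qed.

Fact softHom_compm1 X Y (u : softHom X Y) : softHom_comp u (softHom_id X) = u.
Proof. by apply/softHom_eq; split=> //; apply: multiplicative_eq. Qed.

Fact softHom_compA X Y Z W
    (w : softHom Z W) (v : softHom Y Z) (u : softHom X Y) :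
  softHom_comp w (softHom_comp v u) = softHom_comp (softHom_comp w v) u.
Proof. by apply/softHom_eq; split=> //; apply: multiplicative_eq. Qed.

Definition SGp : category :=
  Category softHom_comp1m softHom_compm1 softHom_compA.

Fact unit_softGroup_subproof (G : groupType) (E : Type) (a : E) :
  forall _ : [set a], group_closed [in [set 1 : G]].
Proof.
move=> _; split=> [|x y]; rewrite !inE //= => -> ->.
by rewrite mulgV.
Qed.

Definition unit_softGroup (G : groupType) (E : Type) (a : E) : softGroup :=
  @SoftGroup G E [set a] (fun=> [set 1]) (@unit_softGroup_subproof G E a).

(* Main.v *)
Require Import Defs.
From mathcomp Require Import all_boot.
From mathcomp Require Import boolp classical_sets.

(** A one-element group receives exactly one homomorphism from any group, and
    a one-element parameter set receives exactly one map, so a soft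
    homomorphism into the trivial soft group is unique because its two
    components are.  For existence, the only candidate is the pair of constant
    maps; it is a soft homomorphism because every [sgFun X x], being a
    subgroup, contains 1 and hence is nonempty, so that its image under the
    constant map is the whole trivial group rather than the empty set. *)

Lemma sgFun1 (X : softGroup) (x : sgParam X) : sgFun X x 1%g.
Proof. by have [/set_mem] := sgFun_closed x. Qed.

(** The image of a nonempty set under the constant map 1 is the singleton of 1;
    [sgFun1] supplies the nonemptiness. *)
Lemma to_unit_softGroup_subproof (G : groupType) (E : Type) (a : E)
    (X : softGroup) :
  (image^~ (@one_fun (sgGroup X) G) \o sgFun X
   = sgFun (unit_softGroup G a) \o (fun=> SigSub (mem_set (erefl a))))%classic.
Proof.
apply/funext => x /=; apply/seteqP; split=> [_ [y _ <-] //|_ ->].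
by exists 1%g => //; apply: sgFun1.
Qed.

Definition to_unit_softGroup (G : groupType) (E : Type) (a : E)
    (X : softGroup) : softHom X (unit_softGroup G a) :=
  @SoftHom X (unit_softGroup G a) (@one_fun (sgGroup X) G)
    (fun=> SigSub (mem_set (erefl a))) (to_unit_softGroup_subproof G E a X).

Theorem theorem4p1 (T : groupType) (hT : [set: T]%classic = [set 1%g]%classic)
    (E : Type) (a : E) :
  @is_final SGp (unit_softGroup T a).
Proof.
have T1 (t : T) : t = 1%g by have : [set: T]%classic t by []; rewrite hT.
move=> X; exists (to_unit_softGroup T E a X); split=> // u _.
apply/softHom_eq; split.
  by apply: multiplicative_eq; apply/funext => x; rewrite [RHS]T1.
by apply/funext => x; apply: val_inj; rewrite /= (set_valP (shPar u x)).
Qed.
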